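(* Let $\mathcal G=(V,E)$ be a finite graph, $T$ a finite set of tiles on $\mathcal G$ all of the same size $\delta$, and $w:T\to\mathbb R_{>0}$ a weight function, with tiling polynomial $P$. Let $\vec\alpha=(\alpha_v)_{v\in V}\in\mathcal M_{\mathbb R}$ with $\alpha_v>0$ for all $v$ and $\sum_v\alpha_v=\delta$. Let $\mathbf N=(N_v)_{v\in V}$ run through a sequence of multiplicity vectors in $\mathcal M_{\mathbb Z}$ with $N_v\to\infty$ for every $v$ and $N_v/K\to\alpha_v$ for every $v$, where $K=\frac1\delta\sum_vN_v$ is the total number of tiles. Let $\mathrm x=(\mathrm x_v)_{v\in V}\in\mathbb R_{>0}^V$ be a positive solution of the criticality equations $$\frac{x_v\,\partial P/\partial x_v}{P}=\alpha_v\qquad(v\in V).$$ Then $$\lim_{K\to\infty}\frac1K\log\left(\frac{K!}{\prod_vN_v!}\,Z(w,\mathbf N)\right)=\log P(\mathrm x)-\sum_{v\in V}\alpha_v\log \mathrm x_v .$$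
   Context: A tile $t$ on $\mathcal G$ is a multiset of vertices, with $t_v\in\mathbb Z_{\ge0}$ the multiplicity of $v\in V$ in $t$; its size is $\sum_vt_v$. For multiplicities $\mathbf N=(N_v)_{v\in V}\in(\mathbb Z_{\ge0})^V$, the blow-up $\mathcal G_{\mathbf N}$ is obtained by replacing each vertex $v$ by $N_v$ vertices (lying above $v$) and each edge $uv$ by $K_{N_u,N_v}$. A lift of $t$ is a choice, for each $v$, of a set of $t_v$ distinct vertices of $\mathcal G_{\mathbf N}$ above $v$. An $\mathbf N$-fold tiling is a partition of the vertices of $\mathcal G_{\mathbf N}$ into lifts of tiles of $T$; $\Omega(\mathbf N)$ is the set of these. The partition function is $Z(w,\mathbf N)=\sum_{m\in\Omega(\mathbf N)}\prod_{t}w_t^{m(t)}$, where $m(t)$ is the number of lifts of $t$ used in $m$. The tiling polynomial is $P(x)=\sum_{t\in T}w_t\prod_{v\in V}\frac{x_v^{t_v}}{t_v!}$. Let $D:\mathbb R^T\to\mathbb R^V$ be the linear map $D(e_t)=\sum_vt_ve_v$. The feasible multiplicities are $\mathcal M_{\mathbb Z}=D((\mathbb Z_{\ge0})^T)$, and $\mathcal M_{\mathbb R}=D((\mathbb R_{>0})^T)$ is the real cone of feasible multiplicities. *)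

(* Defs.v *)
From HB Require Import structures.
From mathcomp Require Import all_boot all_order all_algebra.
From mathcomp Require Import finmap multiset.
From mathcomp Require Import all_classical all_reals all_analysis.

Set Implicit Arguments.
Unset Strict Implicit.
Unset Printing Implicit Defensive.

Import Order.TTheory GRing.Theory Num.Theory.
Import numFieldNormedType.Exports.

Local Open Scope ring_scope.

Record sgraph := SGraph {
  vertex :> finType;
  edge : rel vertex;
  edge_sym : symmetric edge;
  edge_irr : irreflexive edge }.

Definition tile (G : sgraph) := {mset G}%mset.

Definition tile_size (G : sgraph) (t : tile G) : nat := (\sum_(v : G) t v)%N.

Definition blowup_vertex (G : sgraph) (N : G -> nat) : finType :=
  {v : G & 'I_(N v)}.

Definition blowup_edge (G : sgraph) (N : G -> nat) : rel (blowup_vertex N) :=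
  fun a b => edge (tag a) (tag b).

Lemma blowup_edge_sym (G : sgraph) (N : G -> nat) :
  symmetric (@blowup_edge G N).
Proof. by move=> a b; apply: edge_sym. Qed.

Lemma blowup_edge_irr (G : sgraph) (N : G -> nat) :
  irreflexive (@blowup_edge G N).
Proof. by move=> a; apply: edge_irr. Qed.

Definition blowup (G : sgraph) (N : G -> nat) : sgraph :=
  SGraph (@blowup_edge_sym G N) (@blowup_edge_irr G N).

(* The vertex of [G] above which the vertex [a] of the blow-up lies. *)
Definition above (G : sgraph) (N : G -> nat) (a : blowup N) : G := tag a.

(* A lift of [t] chooses a set of [t v] vertices above each [v]; as these sets
   are disjoint for distinct [v], it is encoded by their union [B]. *)
Definition is_lift (G : sgraph) (N : G -> nat) (t : tile G)
    (B : {set blowup N}) : bool :=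
  [forall v, #|[set a in B | above a == v]| == t v].

(* Blocks of a [partition] are nonempty, so a tile of size 0 is never used;
   this is immaterial for tiles of common size [delta > 0]. *)
Definition tilings (G : sgraph) (T : {fset tile G}) (N : G -> nat) :
    {set {set {set blowup N}}} :=
  [set m : {set {set blowup N}} | finset.partition m [set: blowup N]
     & [forall B in m, [exists t : T, is_lift (val t) B]]].

Definition nlifts (G : sgraph) (N : G -> nat) (m : {set {set blowup N}})
    (t : tile G) : nat :=
  #|[set B in m | is_lift t B]|.

Section Weighted.
Variables (R : realType) (G : sgraph) (T : {fset tile G}).

Definition partition_function (w : T -> R) (N : G -> nat) : R :=
  \sum_(m in tilings T N) \prod_(t : T) w t ^+ nlifts m (val t).

Definition tiling_poly (w : T -> R) (x : G -> R) : R :=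
  \sum_(t : T) w t * \prod_(v : G) (x v ^+ (val t v) / ((val t v)`!)%:R).

Definition tile_map (c : T -> R) : G -> R :=
  fun v => \sum_(t : T) c t * (val t v)%:R.

Definition feasible_int : set (G -> R) :=
  (tile_map @` [set c | forall t, c t \is a Num.nat])%classic.

Definition feasible_real : set (G -> R) :=
  (tile_map @` [set c | forall t, 0 < c t])%classic.

End Weighted.

Definition partial (R : realType) (I : finType) (F : (I -> R) -> R) (i : I)
    (x : I -> R) : R :=
  (fun s : R => F (fun j => if j == i then s else x j))^`()%classic (x i).

(* The number of tiles; the division is exact when [N] is a feasible integer
   multiplicity vector and all tiles have size [delta]. *)
Definition num_tiles (G : sgraph) (delta : nat) (N : G -> nat) : nat :=
  ((\sum_(v : G) N v) %/ delta)%N.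

(* Main.v *)
Require Import Defs.
From HB Require Import structures.
From mathcomp Require Import all_boot all_order all_algebra.
From mathcomp Require Import finmap multiset.
From mathcomp Require Import all_classical all_reals all_analysis.
From mathcomp Require Import finset ring lra.

Set Implicit Arguments.
Unset Strict Implicit.
Unset Printing Implicit Defensive.

Import Order.TTheory GRing.Theory Num.Theory.
Import numFieldNormedType.Exports.

Local Open Scope ring_scope.

(** Writing [c t = w t / prod_v (t v)!], counting ordered tilings gives
    [K! / prod_v (N v)! * Z = [x^N] P(x)^K], with [P(x) = sum_t c t * x^t].
    Dropping the other monomials of [P(x)^K] bounds this coefficient above by
    [P(x)^K / x^N], whatever the positive point [x].  At a critical point
    [p t = c t * x^t / P(x)] is a probability on the tiles with mean [alpha].
    Rounding [K * p] inside the lattice of integral solutions of [D m = N]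
    gives tile counts [m] with [m t / K --> p t]; the single term
    [K! / prod_t (m t)! * prod_t (c t)^(m t)] of the coefficient has
    exponential growth rate [- sum_t p t * ln (p t / c t)], which is the upper
    bound. *)

(** * Multinomial counting *)

Lemma sum_ffun_ordS (M : nmodType) (I : finType) n
    (F : {ffun 'I_n.+1 -> I} -> M) :
  \sum_f F f = \sum_k \sum_(g : {ffun 'I_n -> I})
    F [ffun i => oapp g k (unlift ord0 i)].
Proof.
rewrite pair_big /=.
rewrite (reindex (fun p : I * {ffun 'I_n -> I} =>
  [ffun i => oapp p.2 p.1 (unlift ord0 i)])) //=.
exists (fun f : {ffun 'I_n.+1 -> I} => (f ord0, [ffun i => f (lift ord0 i)])).
  move=> [k g] _ /=; congr pair; first by rewrite ffunE unlift_none.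
  by apply/ffunP => i; rewrite !ffunE liftK.
move=> f _; apply/ffunP => i; rewrite ffunE /=.
by case: unliftP => [j|] -> //=; rewrite ffunE.
Qed.

(** For each colour [v] this is the multinomial count of the ways to distribute the class of [v]
    over [I], cleared of denominators. The induction removes the first element, of colour [v0].
    Sending it to [k] pulls the factor [s (k, v0)] out of a factorial, and these factors add up over
    [k] to the size of the class of [v0]. *)
Lemma card_ffun_fibers_ord (I V : finType) n (c : 'I_n -> V)
    (s : I * V -> nat) :
  (forall v, \sum_k s (k, v) = \sum_i (c i == v))%N ->
  ((\sum_(f : {ffun 'I_n -> I})
      [forall p, \sum_i ((f i, c i) == p) == s p]) * \prod_p (s p)`! =
   \prod_v (\sum_i (c i == v))`!)%N.
Proof.
elim: n c s => [|n IHn] c s hs.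
  have s0 p : s p = 0%N.
    case: p => k v; move: (hs v); rewrite big_ord0 => /eqP.
    by rewrite sum_nat_eq0 => /forallP/(_ k)/eqP.
  rewrite [RHS]big1 => [|v _]; last by rewrite big_ord0.
  rewrite [X in (_ * X)%N]big1 => [|p _]; last by rewrite s0.
  rewrite (eq_bigr (fun=> 1%N)) => [|f _]; last first.
    by apply/eqP; rewrite eqb1; apply/forallP => p; rewrite big_ord0 s0.
  by rewrite sum1_card card_ffun card_ord expn0 mul1n.
set v0 := c ord0; pose c' i := c (lift ord0 i).
have cE v : (\sum_i (c i == v) = (v0 == v) + \sum_i (c' i == v))%N.
  by rewrite big_ord_recl.
have -> : (\prod_v (\sum_i (c i == v))`! =
   (\sum_i (c i == v0)) * \prod_v (\sum_i (c' i == v))`!)%N.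
  rewrite (bigD1 v0) //= [in RHS](bigD1 v0) //= mulnA cE eqxx add1n factS.
  congr (_ * _)%N; apply: eq_bigr => v /negPf vv0.
  by rewrite cE eq_sym vv0.
rewrite (sum_ffun_ordS (M := nat)) -hs !big_distrl /=; apply: eq_bigr => k _.
(* When [s (k, v0)] is 0 no admissible map sends the first element to [k]. Otherwise the truncated
   subtraction in [s'] is exact. *)
case: (posnP (s (k, v0))) => [s0|s_gt0].
  rewrite s0 mul0n big1 ?mul0n // => g _.
  case: forallP => // /(_ (k, v0)).
  by rewrite big_ord_recl ffunE unlift_none /= eqxx s0.
pose s' p := (s p - ((k, v0) == p))%N.
have sE p : s p = (((k, v0) == p) + s' p)%N.
  by rewrite /s' subnKC //; case: eqP => // <-.
have -> : (\prod_p (s p)`! = s (k, v0) * \prod_p (s' p)`!)%N.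
  rewrite (bigD1 (k, v0)) //= [in RHS](bigD1 (k, v0)) //= mulnA.
  rewrite [s (k, v0)]sE eqxx add1n factS.
  congr (_ * _)%N; apply: eq_bigr => p /negPf pk.
  by rewrite sE eq_sym pk.
rewrite mulnCA; congr (_ * _)%N.
rewrite -(IHn c' s') => [|v]; last first.
  have := hs v; rewrite cE.
  rewrite (eq_bigr (fun k' => (((k, v0) == (k', v)) : nat) + s' (k', v))%N);
    last by move=> k' _; exact: sE.
  rewrite big_split /=.
  rewrite (bigD1 k) //= big1 ?addn0 => [|k' /negPf kk']; last first.
    by rewrite xpair_eqE eq_sym kk'.
  by rewrite xpair_eqE eqxx /= => /addnI.
congr (_ * _)%N; apply: eq_bigr => g _; congr (nat_of_bool _).
apply: eq_forallb => p; rewrite big_ord_recl ffunE unlift_none /= -/v0.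
rewrite [s p]sE eqn_add2l; congr (_ == _).
by apply: eq_bigr => i _; rewrite ffunE liftK.
Qed.

(** Used twice: with the vertices of the blow-up coloured by [above], to count lifts, and with a
    single colour, to count words of a given type. *)
Lemma card_ffun_fibers (A I V : finType) (c : A -> V) (s : I * V -> nat) :
  (forall v, \sum_k s (k, v) = #|[pred a | c a == v]|)%N ->
  (#|[pred f : {ffun A -> I} |
       [forall p, #|[pred a | (f a, c a) == p]| == s p]]|
     * \prod_p (s p)`! = \prod_v (#|[pred a | c a == v]|)`!)%N.
Proof.
have cardE (P : pred A) : #|[pred a | P a]| = (\sum_(i < #|A|) P (enum_val i))%N.
  rewrite -sum1_card big_mkcond /= (reindex (@enum_val A A)) /=; last first.
    by apply: onW_bij; exact: enum_val_bij.
  by apply: eq_bigr => i _; rewrite inE; case: (P _).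
move=> hs; have := @card_ffun_fibers_ord I V #|A| (c \o enum_val) s.
rewrite [in RHS](eq_bigr (fun v => (#|[pred a | c a == v]|)`!)%N) => [|v _]; last first.
  by rewrite cardE.
move=> <-; last by move=> v; rewrite hs cardE.
congr (_ * _)%N.
rewrite -[LHS]sum1_card big_mkcond /=.
rewrite (reindex (fun f : {ffun 'I_#|A| -> I} => [ffun a => f (enum_rank a)])).
  apply: eq_bigr => f _; rewrite inE.
  apply: (congr1 nat_of_bool).
  apply: eq_forallb => p; rewrite cardE; congr (_ == _).
  by apply: eq_bigr => i _; rewrite ffunE enum_valK.
exists (fun f : {ffun A -> I} => [ffun i => f (enum_val i)]) => f _;
  by apply/ffunP => i; rewrite !ffunE (enum_rankK, enum_valK).
Qed.

(** Such an [f] is a numbering of the blocks of [P]: taking fibers is a bijection onto the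
    injections from ['I_n] to [P]. *)
Lemma card_ffun_partition (A : finType) n (P : {set {set A}}) :
  partition P [set: A] -> #|P| = n ->
  #|[pred f : {ffun A -> 'I_n} | [set [set a | f a == k] | k : 'I_n] == P]|
    = n`!.
Proof.
move=> partP cardP; have [/eqP covP trivP P0] := and3P partP.
pose fib (f : {ffun A -> 'I_n}) := [ffun k => [set a | f a == k]].
have fib_inj : injective fib.
  move=> f g /ffunP fg; apply/ffunP => a; apply/esym/eqP.
  by have := fg (f a); rewrite !ffunE => /setP/(_ a); rewrite !inE eqxx.
have -> : n`! = #|[set g : {ffun 'I_n -> {set A}} in ffun_on (mem P) |
                     injectiveb g]|.
  by rewrite card_inj_ffuns_on cardP card_ord ffactnn.
rewrite -(card_imset _ fib_inj); apply: eq_card => g; rewrite !inE.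
apply/imsetP/andP => [[f] | [/ffun_onP gP /injectiveP g_inj]].
  rewrite inE => /eqP fP ->.
  have gE k : fib f k = [set a | f a == k] by rewrite ffunE.
  split; first by apply/ffun_onP => k; rewrite gE -fP imset_f.
  apply/injectiveP => k k'; rewrite !gE; move: k k'.
  have /imset_injP kinj : #|[set [set a | f a == k] | k : 'I_n]| == #|'I_n|.
    by rewrite fP cardP card_ord.
  by move=> k k'; apply: kinj.
have imP : [set g k | k : 'I_n] = P.
  apply/eqP; rewrite eqEcard card_imset // card_ord cardP leqnn andbT.
  by apply/fintype.subsetP => B /imsetP[k _ ->].
have /fin_all_exists[f fP] (a : A) : exists k, a \in g k.
  have : a \in cover P by rewrite covP inE.
  by case/bigcupP => B; rewrite -imP => /imsetP[k _ ->]; exists k.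
have fE k : [set a | f a == k] = g k.
  apply/setP => a; rewrite inE; apply/eqP/idP => [<-//|agk].
  apply/g_inj/eqP; apply: contraT => ne.
  have /trivIsetP/(_ _ _ (gP (f a)) (gP k) ne) := trivP.
  by move/disjoint_setI0/setP/(_ a); rewrite !inE fP agk.
exists (finfun f).
  rewrite inE -imP; apply/eqP; apply: eq_imset => k.
  by rewrite -fE; apply/setP => a; rewrite !inE ffunE.
by apply/ffunP => k; rewrite ffunE -fE; apply/setP => a; rewrite !inE ffunE.
Qed.

(** A map that misses a value has an empty fiber and contributes 0. The surjective maps are grouped
    by their partition into fibers, each partition arising from its [n!] numberings. *)
Lemma sum_ffun_fibers (R : comNzRingType) (A : finType) n (W : {set A} -> R) :
  W set0 = 0 ->
  \sum_(f : {ffun A -> 'I_n}) \prod_k W [set a | f a == k] =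
  n`!%:R * \sum_(P | partition P [set: A] && (#|P| == n))
             \prod_(B in P) W B.
Proof.
move=> W0; pose ker (f : {ffun A -> 'I_n}) := [set [set a | f a == k] | k : 'I_n].
pose surj (f : {ffun A -> 'I_n}) := [forall k, [set a | f a == k] != set0].
have fib_inj f : surj f -> injective (fun k => [set a | f a == k]).
  move=> /forallP fsurj k k' kk'; have /set0Pn[a ak] := fsurj k.
  by move: (ak); rewrite kk'; move: ak; rewrite !inE => /eqP-> /eqP.
have kerP f : surj f ->
    partition (ker f) [set: A] && (#|ker f| == n).
  move=> fsurj; apply/andP; split; last first.
    by rewrite card_imset ?card_ord //; exact: fib_inj.
  apply/and3P; split.
  - apply/eqP/setP => a; rewrite inE; apply/bigcupP.
    by exists [set b | f b == f a]; rewrite ?imset_f // inE.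
  - apply/trivIsetP => _ _ /imsetP[k _ ->] /imsetP[k' _ ->] ne.
    rewrite -setI_eq0; apply: contraNT ne => /set0Pn[a].
    by rewrite !inE => /andP[/eqP-> /eqP->].
  - apply/imsetP => -[k _ k0]; move/forallP/(_ k): fsurj.
    by rewrite -k0 eqxx.
rewrite (bigID surj) /= [X in _ + X]big1 ?addr0 => [|f]; last first.
  rewrite negb_forall => /existsP[k]; rewrite negbK => /eqP fk.
  by rewrite (bigD1 k) //= fk W0 mul0r.
rewrite (partition_big ker (fun P => partition P [set: A] && (#|P| == n)) kerP).
rewrite mulr_sumr; apply: eq_bigr => P; case/andP => partP /eqP cardP.
rewrite (eq_bigr (fun=> \prod_(B in P) W B)) => [|f /andP[fs /eqP <-]]; last first.
  by rewrite big_imset //= => k k' _ _; apply: fib_inj.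
rewrite sumr_const -(card_ffun_partition partP cardP) mulr_natl.
congr (_ *+ _); apply: eq_card => f; rewrite !unfold_in /= andbC /ker.
(* A map whose fibers form the partition [P] is surjective, since [P] has no empty block. *)
case: eqP => //= fP; apply/forallP => k; apply: contraTN partP => /eqP fk.
by rewrite /partition -fP -fk imset_f ?andbF.
Qed.

(** * From tilings to coefficients of powers *)

Lemma is_lift_inj (G : sgraph) (N : G -> nat) (t t' : tile G)
    (B : {set blowup N}) : is_lift t B -> is_lift t' B -> t = t'.
Proof.
move=> /forallP tB /forallP t'B; apply/msetP => v.
by move: (tB v) (t'B v) => /eqP <- /eqP <-.
Qed.

Lemma card_is_lift (G : sgraph) (N : G -> nat) (t : tile G)
    (B : {set blowup N}) : is_lift t B -> #|B| = tile_size t.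
Proof.
move=> /forallP tB; rewrite -sum1_card (partition_big (@above G N) xpredT) //=.
apply: eq_bigr => v _; rewrite -(eqP (tB v)) -sum1_card.
by apply: eq_bigl => a; rewrite !inE.
Qed.

Lemma card_blowup (G : sgraph) (N : G -> nat) :
  #|blowup N| = (\sum_v N v)%N.
Proof.
rewrite card_tagged sumnE big_map big_enum /=.
by apply: eq_bigr => v _; rewrite card_ord.
Qed.

Lemma card_above (G : sgraph) (N : G -> nat) (v : G) :
  #|[pred a : blowup N | above a == v]| = N v.
Proof.
rewrite -[RHS]card_ord -(card_imset predT (f := Tagged (fun v => 'I_(N v)))).
  apply: eq_card => a; rewrite inE; apply/eqP/imsetP => [<-|[i _ ->] //].
  by exists (tagged a); case: a.
by move=> i j /eqP; rewrite eq_Tagged => /eqP.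
Qed.

Section LiftWeight.
Variables (R : realType) (G : sgraph) (T : {fset tile G}) (delta : nat).
Hypotheses (delta_gt0 : (0 < delta)%N)
           (sizeT : forall t : T, tile_size (val t) = delta).
Variables (w : T -> R) (N : G -> nat).

(* At most one term is present, since a set is a lift of at most one tile;
   the weight of a non-lift is 0. *)
Definition lift_weight (B : {set blowup N}) : R :=
  \sum_(t : T | is_lift (val t) B) w t.

Lemma lift_weight_prod (B : {set blowup N}) :
  [exists t : T, is_lift (val t) B] ->
  lift_weight B = \prod_(t : T | is_lift (val t) B) w t.
Proof.
move=> /existsP[t tB]; rewrite /lift_weight.
have tE t' : is_lift (val t') B = (t' == t).
  by apply/idP/eqP => [t'B|-> //]; apply/val_inj/(is_lift_inj t'B tB).
by rewrite !(eq_bigl _ _ tE) !big_pred1_eq.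
Qed.

Lemma lift_weight_eq0 (B : {set blowup N}) : #|B| != delta -> lift_weight B = 0.
Proof.
move=> Bd; rewrite /lift_weight big1 // => t tB.
by rewrite (card_is_lift tB) sizeT eqxx in Bd.
Qed.

(* Partitions with a block that is not a lift contribute 0. *)
Lemma partition_function_lift_weight :
  partition_function w N =
  \sum_(P | partition P [set: blowup N]) \prod_(B in P) lift_weight B.
Proof.
rewrite [RHS](bigID (fun P => P \in tilings T N)) /= [X in _ + X]big1 ?addr0.
  apply: eq_big => [P|P]; first by rewrite !inE; case: partition.
  rewrite inE => /andP[_ /forall_inP liftP].
  rewrite [RHS](eq_bigr (fun B =>
      \prod_(t : T) if is_lift (val t) B then w t else 1)) => [|B BP]; last first.
    by rewrite lift_weight_prod ?liftP // big_mkcond.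
  rewrite exchange_big /=; apply: eq_bigr => t _.
  rewrite -big_mkcondr -prodr_const; apply: eq_bigl => B.
  by rewrite !inE.
move=> P /andP[partP]; rewrite inE partP /= => /forall_inPn[B BP].
move=> /existsPn noB; rewrite (bigD1 B) //= /lift_weight big1 ?mul0r // => t.
by rewrite (negPf (noB t)).
Qed.

(** The factor [K!] numbers the tiles, so that [f] sends a vertex to the index of the tile covering
    it. A partition of nonzero weight has all its blocks of size [delta], hence exactly [K] of
    them. *)
Lemma fact_partition_function K : (\sum_v N v = K * delta)%N ->
  K`!%:R * partition_function w N =
  \sum_(f : {ffun blowup N -> 'I_K})
     \prod_k lift_weight [set a | f a == k].
Proof.
move=> sumN; rewrite sum_ffun_fibers; last first.
  by apply: lift_weight_eq0; rewrite cards0 eq_sym -lt0n.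
rewrite partition_function_lift_weight; congr (_ * _).
rewrite (bigID (fun P : {set {set blowup N}} => #|P| == K)) /=.
rewrite [X in _ + X]big1 ?addr0 // => P /andP[partP].
apply: contraNeq => /prodf_neq0 PW.
rewrite -(eqn_pmul2r delta_gt0) -sumN -card_blowup -cardsT.
rewrite (@card_uniform_partition _ delta _ _ _ partP) // => B BP.
by apply/eqP; apply: contraNT (PW B BP) => /lift_weight_eq0 ->.
Qed.

(** With the tile of each index prescribed, the vertices above each [v] are distributed
    independently, which gives one multinomial coefficient per [v]. There is no distribution unless
    the multiplicities add up to [N]. *)
Lemma card_lift_ffun K (s : {ffun 'I_K -> T}) :
  #|[pred f : {ffun blowup N -> 'I_K} |
      [forall k, is_lift (val (s k)) [set a | f a == k]]]|%:R =
  [forall v, \sum_k val (s k) v == N v]%N%:R * (\prod_v (N v)`!)%:R /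
    \prod_k \prod_v (val (s k) v)`!%:R :> R.
Proof.
have neq0 : \prod_k \prod_v (val (s k) v)`!%:R != 0 :> R.
  by apply/prodf_neq0 => k _; apply/prodf_neq0 => v _; rewrite pnatr_eq0 -lt0n fact_gt0.
apply: (canRL (mulfK neq0)).
pose S (p : 'I_K * G) := val (s p.1) p.2.
have fibE (f : {ffun blowup N -> 'I_K}) :
  [forall k, is_lift (val (s k)) [set a | f a == k]] =
  [forall p, #|[pred a | (f a, above a) == p]| == S p]%N.
  apply/forallP/forallP => [H [k v]|H k].
    rewrite /S /=; move/forallP/(_ v): (H k) => /eqP <-; apply/eqP/eq_card => a.
    by rewrite !inE xpair_eqE.
  apply/forallP => v; have /eqP := H (k, v); rewrite /S /= => <-; apply/eqP/eq_card => a.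
  by rewrite !inE xpair_eqE.
case: forallP => [sN|sN]; last first.
  rewrite mul0r; apply/eqP; rewrite mulf_eq0 (negPf neq0) orbF pnatr_eq0.
  apply/eqP/eq_card0 => f; rewrite inE fibE; apply/negP => /forallP fS.
  apply: sN => v; rewrite -card_above -sum1_card.
  rewrite (partition_big f xpredT) //=; apply/eqP/eq_bigr => k _.
  have /eqP := fS (k, v); rewrite /S /= => <-; rewrite -sum1_card; apply: eq_bigl => a.
  by rewrite !inE xpair_eqE andbC.
rewrite mul1r -(@eq_bigr _ _ _ _ _ _
    (fun v => (#|[pred a : blowup N | above a == v]|)`!)%N) => [|v _];
  last by rewrite card_above.
rewrite -(@card_ffun_fibers _ 'I_K _ _ S) => [|v]; last first.
  by rewrite card_above; apply/eqP/sN.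
rewrite natrM; congr (_ * _).
  by congr (_%:R); apply: eq_card => f; rewrite !inE fibE.
by rewrite pair_big natr_prod.
Qed.

(** Double counting of pairs of a numbered tiling [f] and the sequence [s] of its tiles: the product
    of the [lift_weight] sums is expanded over [s], then [f] is summed first. *)
Lemma partition_functionE K : (\sum_v N v = K * delta)%N ->
  K`!%:R / (\prod_v (N v)`!)%:R * partition_function w N =
  \sum_(s : {ffun 'I_K -> T} | [forall v, \sum_k val (s k) v == N v]%N)
     \prod_k (w (s k) / \prod_v (val (s k) v)`!%:R).
Proof.
move=> sumN; rewrite mulrAC fact_partition_function //.
have neq0 : (\prod_v (N v)`!)%:R != 0 :> R.
  by rewrite pnatr_eq0 -lt0n prodn_gt0 // => v; rewrite fact_gt0.
apply: (canLR (mulfK neq0)); rewrite mulr_suml.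
have fE (f : {ffun blowup N -> 'I_K}) :
    \prod_k lift_weight [set a | f a == k] =
    \sum_(s : {ffun 'I_K -> T}) \prod_k
      if is_lift (val (s k)) [set a | f a == k] then w (s k) else 0.
  rewrite -(bigA_distr_bigA (fun k t =>
    if is_lift (val t) [set a | f a == k] then w t else 0)).
  by apply: eq_bigr => k _; rewrite /lift_weight big_mkcond.
rewrite (eq_bigr _ (fun f _ => fE f)).
rewrite exchange_big [RHS]big_mkcond /=; apply: eq_bigr => s _.
transitivity (#|[pred f : {ffun blowup N -> 'I_K} |
      [forall k, is_lift (val (s k)) [set a | f a == k]]]|%:R * \prod_k w (s k)).
  rewrite -sum1_card natr_sum mulr_suml [RHS]big_mkcond; apply: eq_bigr => f _.
  rewrite inE /=; case: ifP => [/forallP H|/negbT].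
    by rewrite mul1r; apply: eq_bigr => k _; rewrite H.
  rewrite negb_forall => /existsP[k /negPf H].
  by rewrite (bigD1 k) //= H mul0r.
rewrite card_lift_ffun prodf_div; case: forallP => _; last by rewrite !mul0r.
by rewrite mul1r mulrAC -mulrA mulrC.
Qed.
End LiftWeight.

(** * Bounds on the coefficients of a power *)

Section PowerCoefficient.
Variables (R : realType) (T V : finType) (a : T -> V -> nat) (c : T -> R).
Hypothesis c_gt0 : forall t, 0 < c t.

(** The coefficient of [x^N] in the [K]-th power of [sum_t c t * x^(a t)], as a sum over words of
    length [K] in the tiles. *)
Definition power_coef (K : nat) (N : V -> nat) : R :=
  \sum_(s : {ffun 'I_K -> T} | [forall v, \sum_k a (s k) v == N v]%N)
    \prod_k c (s k).

Lemma power_coef_le K N (x : V -> R) : (forall v, 0 < x v) ->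
  power_coef K N * \prod_v x v ^+ N v <=
  (\sum_t c t * \prod_v x v ^+ a t v) ^+ K.
Proof.
move=> x_gt0; rewrite -[X in _ <= _ ^+ X]card_ord -prodr_const bigA_distr_bigA.
rewrite [leRHS](bigID (fun s : {ffun 'I_K -> T} =>
  [forall v, \sum_k a (s k) v == N v]%N)) /= mulr_suml.
rewrite (eq_bigr (fun s : {ffun 'I_K -> T} =>
    \prod_k (c (s k) * \prod_v x v ^+ a (s k) v))).
  rewrite lerDl sumr_ge0 // => s _; apply: prodr_ge0 => k _.
  rewrite mulr_ge0 ?(ltW (c_gt0 _)) // prodr_ge0 // => v _.
  by rewrite exprn_ge0 // ltW.
move=> s /forallP sN; rewrite big_split /=; congr (_ * _).
rewrite exchange_big /=; apply: eq_bigr => v _.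
by rewrite -(eqP (sN v)) prodrXr.
Qed.

(** Only the words in which each [t] occurs [m t] times are kept; they all have the same weight, and
    their number is a multinomial coefficient. *)
Lemma power_coef_ge K N (m : T -> nat) :
  (\sum_t m t = K)%N -> (forall v, \sum_t m t * a t v = N v)%N ->
  K`!%:R / (\prod_t (m t)`!)%:R * \prod_t c t ^+ m t <= power_coef K N.
Proof.
move=> mK mN.
pose type (s : {ffun 'I_K -> T}) :=
  [forall p, #|[pred k | (s k, tt) == p]| == m p.1].
have card_type : (#|[pred s | type s]| * \prod_t (m t)`! = K`!)%N.
  have cardK v : #|[pred k : 'I_K | tt == v]| = K.
    by case: v; rewrite -[RHS]card_ord; apply: eq_card.
  have prodE : (\prod_(p : T * unit) (m p.1)`! = \prod_t (m t)`!)%N.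
    rewrite -(pair_bigA _ (fun t _ => (m t)`!)) /=; apply: eq_bigr => t _.
    by rewrite (big_pred1 tt) // => -[].
  rewrite -prodE (@card_ffun_fibers 'I_K T unit (fun=> tt) (fun p => m p.1)).
    by rewrite (big_pred1 tt) ?cardK // => -[].
  by move=> v; rewrite cardK mK.
have fibE s t : type s -> #|[pred k | s k == t]| = m t.
  move=> /forallP/(_ (t, tt))/eqP/= <-; apply: eq_card => k.
  by rewrite !inE xpair_eqE andbT.
have typeN s v : type s -> (\sum_k a (s k) v = N v)%N.
  move=> sm; rewrite -mN (partition_big s xpredT) //=; apply: eq_bigr => t _.
  rewrite -(fibE _ _ sm) -sum_nat_const; apply: eq_bigr => k /eqP -> //.
have typeE : \sum_(s in type) \prod_k c (s k) =
    K`!%:R / (\prod_t (m t)`!)%:R * \prod_t c t ^+ m t.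
  rewrite [LHS](eq_bigr (fun=> \prod_t c t ^+ m t)) => [|s sm].
    rewrite sumr_const -[LHS]mulr_natl -card_type natrM mulfK.
      by congr (_%:R * _); apply: eq_card.
    by rewrite pnatr_eq0 -lt0n prodn_gt0 // => t; rewrite fact_gt0.
  rewrite (partition_big s xpredT) //=; apply: eq_bigr => t _.
  rewrite -(fibE _ _ sm) -prodr_const; apply: eq_big => // k.
  by move=> /eqP ->.
rewrite /power_coef -typeE [leRHS](bigID type) /=.
rewrite [X in _ <= X + _](eq_bigl type) => [|s].
  by rewrite lerDl sumr_ge0 // => s _; apply: prodr_ge0 => k _; apply: ltW.
by apply/andP/idP => [[]//|sm]; split=> //; apply/forallP => v; rewrite typeN.
Qed.
End PowerCoefficient.

(** * Integral points near a real solution *)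

(* [b] is the rational kernel matrix with its denominators cleared. *)
Lemma integral_kernel_span (R : realType) (I J : finType) (a : I -> J -> nat) :
  exists b : 'I_#|I| -> I -> int,
    (forall k j, \sum_i b k i * (a i j)%:Z = 0) /\
    forall z : I -> R, (forall j, \sum_i z i * (a i j)%:R = 0) ->
      exists l : 'I_#|I| -> R, forall i, z i = \sum_k l k * (b k i)%:~R.
Proof.
pose A : 'M[rat]_(#|I|, #|J|) :=
  \matrix_(i, j) (a (enum_val i) (enum_val j))%:R.
pose d : int := \prod_i \prod_j denq (kermx A i j).
have d_neq0 : d%:~R != 0 :> rat.
  by rewrite intr_eq0; apply/prodf_neq0 => i _; apply/prodf_neq0 => j _.
pose b k i := numq (kermx A k (enum_rank i) * d%:~R).
have bE k i : (b k i)%:~R = kermx A k (enum_rank i) * d%:~R.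
  rewrite numqK // /d (bigD1 k) //= (bigD1 (enum_rank i)) //= -mulrA rmorphM.
  by rewrite mulrA -numqE rpredM // intr_int.
exists b; split=> [k j|z z0].
  apply: (@intr_inj rat); rewrite rmorph_sum rmorph0 /=.
  have /matrixP/(_ k (enum_rank j)) := mulmx_ker A.
  rewrite !mxE => /(congr1 ( *%R d%:~R)); rewrite mulr0 => kA0.
  rewrite -[RHS]kA0 mulr_sumr [RHS](reindex (@enum_rank I)) /=; last first.
    by apply: onW_bij; exact: enum_rank_bij.
  apply: eq_bigr => i _; rewrite rmorphM /= bE [A _ _]mxE !enum_rankK.
  by rewrite mulrA [d%:~R * _]mulrC.
pose zr : 'rV[R]_#|I| := \row_i z (enum_val i).
have zA : zr *m map_mx ratr A = 0.
  apply/matrixP => i j; rewrite !mxE -[RHS](z0 (enum_val j)).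
  rewrite [RHS](reindex (@enum_val I I)) /=; last first.
    by apply: onW_bij; exact: enum_val_bij.
  by apply: eq_bigr => k _; rewrite !mxE ratr_nat.
(* Kernels commute with the extension of scalars from the rationals to [R], so the rational kernel
   rows span the real kernel. *)
have /submxP[D zD] : (zr <= map_mx ratr (kermx A))%MS.
  by rewrite map_kermx sub_kermx zA.
have d_neq0R : d%:~R != 0 :> R by rewrite intr_eq0 -(intr_eq0 rat).
exists (fun k => D 0 k / d%:~R) => i.
have /matrixP/(_ 0 (enum_rank i)) := zD; rewrite !mxE enum_rankK => ->.
apply: eq_bigr => k _; rewrite mxE.
have := congr1 (@ratr R) (bE k i); rewrite rmorphM /= !ratr_int => ->.
by move: (D 0 k) (ratr _) (d%:~R) d_neq0R => u v e e0; rewrite mulrCA divfK // mulrC.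
Qed.

(** The difference [y - c] is a real combination of integral kernel vectors; rounding its
    coefficients down keeps an integral solution and moves each coordinate by a bounded amount. The
    constant [C] depends on [a] alone, which makes the error negligible after division by [K]. *)
Lemma integral_combination_near (R : realType) (I J : finType)
    (a : I -> J -> nat) :
  exists C : R, forall (y : I -> R) (c : I -> int),
    (forall j, \sum_i y i * (a i j)%:R = \sum_i (c i)%:~R * (a i j)%:R) ->
    exists m : I -> int,
      (forall j, \sum_i m i * (a i j)%:Z = \sum_i c i * (a i j)%:Z) /\
      (forall i, `|(m i)%:~R - y i| <= C).
Proof.
have [b [b_ker b_span]] := integral_kernel_span R a.
exists (\sum_i \sum_k `|(b k i)%:~R|) => y c yc.
have [|l lE] := b_span (fun i => y i - (c i)%:~R).
  move=> j; under eq_bigr do rewrite mulrBl.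
  by rewrite sumrB yc subrr.
exists (fun i => c i + \sum_k Num.floor (l k) * b k i); split=> [j|i].
  under eq_bigr do rewrite mulrDl mulr_suml.
  rewrite big_split /= exchange_big /= [X in _ + X]big1 ?addr0 // => k _.
  under eq_bigr do rewrite -mulrA.
  by rewrite -mulr_sumr b_ker mulr0.
rewrite (bigD1 i) //=; apply: ler_wpDr.
  by apply: sumr_ge0 => i' _; apply: sumr_ge0.
have -> : (c i + \sum_k Num.floor (l k) * b k i)%:~R - y i =
    \sum_k ((Num.floor (l k))%:~R - l k) * (b k i)%:~R.
  under [RHS]eq_bigr do rewrite mulrBl.
  rewrite sumrB -lE rmorphD rmorph_sum /=.
  under [X in _ + X - _]eq_bigr do rewrite rmorphM.
  by rewrite opprB addrCA addrA.
apply: le_trans (ler_norm_sum _ _ _) _; apply: ler_sum => k _.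
rewrite normrM ler_piMl // distrC ger0_norm ?subr_ge0 ?ge_floor //.
by rewrite lerBlDl ltW // -[X in _ + X]/(1%:~R) -intrD floorD1_gt.
Qed.

(** The pseudo-inverse is a right inverse on the image. As [B] is fixed and acts linearly, a small
    right-hand side [b] gets a small preimage. *)
Lemma linear_section (F : fieldType) (I J : finType) (a : I -> J -> F) :
  exists B : J -> I -> F, forall (z : I -> F) (b : J -> F),
    (forall j, b j = \sum_i z i * a i j) ->
    forall j, \sum_i (\sum_j' b j' * B j' i) * a i j = b j.
Proof.
pose A : 'M[F]_(#|I|, #|J|) := \matrix_(i, j) a (enum_val i) (enum_val j).
exists (fun j i => pinvmx A (enum_rank j) (enum_rank i)) => z b bE j.
pose zr : 'rV[F]_#|I| := \row_i z (enum_val i).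
have bA k : (zr *m A) 0 k = b (enum_val k).
  rewrite mxE bE [RHS](reindex (@enum_val I I)) /=; last first.
    by apply: onW_bij; exact: enum_val_bij.
  by apply: eq_bigr => i _; rewrite !mxE.
have /matrixP/(_ 0 (enum_rank j)) := mulmxKpV (submxMl zr A).
rewrite bA enum_rankK mxE => <-.
rewrite [RHS](reindex (@enum_rank I)) /=; last first.
  by apply: onW_bij; exact: enum_rank_bij.
apply: eq_bigr => i _; rewrite !mxE !enum_rankK; congr (_ * _).
rewrite [RHS](reindex (@enum_rank J)) /=; last first.
  by apply: onW_bij; exact: enum_rank_bij.
by apply: eq_bigr => k _; rewrite bA enum_rankK.
Qed.

(** * Asymptotics *)

(** For positive [n], [n^n / n!] is a single term of the exponential series at [n]. *)
Lemma ln_fact_ge (R : realType) n :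
  n%:R * ln n%:R - n%:R <= ln n`!%:R :> R.
Proof.
case: n => [|n]; first by rewrite mul0r subr0 fact0 ln1.
have n_gt0 : 0 < n.+1%:R :> R by rewrite ltr0n.
have f_gt0 : 0 < (n.+1)`!%:R :> R by rewrite ltr0n fact_gt0.
rewrite lerBlDr -lerBlDl mulr_natl -lnXn // -ln_div ?posrE ?exprn_gt0 //.
rewrite -[leRHS]expRK ler_ln ?posrE ?expR_gt0 ?divr_gt0 ?exprn_gt0 //.
apply: le_trans (expR_ge1Dxn n (ltW n_gt0)).
by rewrite lerDr.
Qed.

(** The induction step amounts to [ln (1 - 1/(n+2)) <= - 1/(n+2)]. The shift to [n.+1] keeps the
    logarithm away from 0 when a tile count vanishes. *)
Lemma ln_fact_le (R : realType) n :
  ln n`!%:R <= n.+1%:R * ln n.+1%:R - n%:R :> R.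
Proof.
elim: n => [|n IHn]; first by rewrite fact0 !ln1 mulr0 subr0.
rewrite factS natrM lnM ?posrE ?ltr0n ?fact_gt0 //.
apply: le_trans (lerD (lexx _) IHn) _.
have n1 : 0 < n.+1%:R :> R by rewrite ltr0n.
have n2 : 0 < n.+2%:R :> R by rewrite ltr0n.
have : ln (n.+1%:R / n.+2%:R) <= - n.+2%:R^-1 :> R.
  have -> : n.+1%:R / n.+2%:R = 1 + - n.+2%:R^-1 :> R.
    apply: (mulIf (lt0r_neq0 n2)); rewrite mulrDl mulNr.
    by rewrite divfK ?mulVf ?lt0r_neq0 // mul1r -[n.+2]addn1 natrD addrK.
  by apply: le_ln1Dx; rewrite ltrN2 invf_lt1 ?ltr1n.
rewrite ln_div ?posrE // -(ler_pM2l n2) mulrN mulfV ?lt0r_neq0 // => H.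
by nra.
Qed.

Local Open Scope classical_set_scope.
Local Open Scope ring_scope.

Lemma cvg_sum (R : realType) (I : finType) (f : I -> nat -> R) (l : I -> R) :
  (forall i, f i n @[n --> \oo] --> l i) ->
  \sum_i f i n @[n --> \oo] --> \sum_i l i.
Proof.
by move=> fl; apply: cvg_big => [|i _]; [exact: add_continuous|exact: fl].
Qed.

Lemma cvg_natr_inv (R : realType) (K : nat -> nat) : K @ \oo --> \oo ->
  (K n)%:R^-1 @[n --> \oo] --> (0 : R).
Proof.
move=> /(@cvgrnyP R) Koo.
apply/(gtr0_cvgV0 (f := fun n => (K n)%:R)) => //.
by have /cvgryPgt/(_ 0) := Koo.
Qed.

(** From [ln k = 2 * ln (sqrt k) <= 2 * sqrt k] the quotient is at most [2 / sqrt k]. *)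
Lemma cvg_ln_natr_div (R : realType) (K : nat -> nat) : K @ \oo --> \oo ->
  (K n)%:R^-1 * ln (K n)%:R @[n --> \oo] --> (0 : R).
Proof.
move=> Koo; have Kinv := @cvg_natr_inv R K Koo.
have /cvgnyPgt/(_ 0%N) K_pos := Koo.
apply: (@squeeze_cvgr _ _ _ _ (fun=> 0) (fun n => 2 * Num.sqrt (K n)%:R^-1)).
- near=> n.
  have K_gt0 : (0 < K n)%N by near: n.
  have k_gt0 : 0 < (K n)%:R :> R by rewrite ltr0n.
  apply/andP; split; first by rewrite mulr_ge0 ?invr_ge0 ?ln_ge0 ?ler1n.
  rewrite ler_pdivrMl // sqrtrV ?(ltW k_gt0) //.
  have s_gt0 : 0 < Num.sqrt (K n)%:R :> R by rewrite sqrtr_gt0.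
  have sE : (K n)%:R = Num.sqrt (K n)%:R ^+ 2 :> R by rewrite sqr_sqrtr // ltW.
  rewrite mulrCA {1}sE lnXn // [X in 2 * (X / _)]sE expr2 mulfK ?lt0r_neq0 //.
  by rewrite -[leLHS]mulr_natl ler_pM2l // ltW // ln_sublinear.
- exact: cvg_cst.
- rewrite -(mulr0 2) -(@sqrtr0 R); apply: cvgMl_tmp; apply: continuous_cvg => //.
  exact: sqrt_continuous.
Unshelve. all: by end_near. Qed.

Lemma ln_prod (R : realType) (I : finType) (f : I -> R) :
  (forall i, 0 < f i) -> ln (\prod_i f i) = \sum_i ln (f i).
Proof.
move=> f_gt0; suff [] : ln (\prod_i f i) = \sum_i ln (f i) /\ 0 < \prod_i f i by [].
elim/big_ind2: _ => [|x1 x2 y1 y2 [<- ?] [<- ?]|i _]; first by rewrite ln1.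
  by rewrite lnM ?posrE ?mulr_gt0.
by rewrite f_gt0.
Qed.

(** The entropy bound for a multinomial coefficient. The frequencies carry the shift of
    [ln_fact_le], so they sum to [1 + #|T| / K]; the first term compensates for the excess. *)
Lemma ln_multinomial_ge (R : realType) (T : finType) (K : nat) (m : T -> nat)
    (c : T -> R) : (0 < K)%N -> (\sum_t m t = K)%N -> (forall t, 0 < c t) ->
  - (#|T|%:R * (K%:R^-1 * ln K%:R))
  - \sum_t ((m t).+1%:R / K%:R) * ln ((m t).+1%:R / K%:R)
  + \sum_t ((m t)%:R / K%:R) * ln (c t)
  <= K%:R^-1 * ln (K`!%:R / (\prod_t (m t)`!)%:R * \prod_t c t ^+ m t).
Proof.
move=> K_gt0 mK c_gt0; have k_gt0 : 0 < K%:R :> R by rewrite ltr0n.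
have fact_gt0R n : 0 < n`!%:R :> R by rewrite ltr0n fact_gt0.
have m_gt0 : 0 < \prod_t (m t)`!%:R :> R by rewrite prodr_gt0.
have cm_gt0 : 0 < \prod_t c t ^+ m t.
  by rewrite prodr_gt0 // => t _; rewrite exprn_gt0.
rewrite natr_prod lnM ?posrE ?divr_gt0 // ln_div ?posrE //.
rewrite !ln_prod // => [|t]; last by rewrite exprn_gt0.
rewrite ler_pdivlMl //.
have -> : \sum_t ln (c t ^+ m t) = \sum_t (m t)%:R * ln (c t).
  by apply: eq_bigr => t _; rewrite lnXn // mulr_natl.
have lem : \sum_t ln (m t)`!%:R <= \sum_t ((m t).+1%:R * ln (m t).+1%:R - (m t)%:R) :> R.
  by apply: ler_sum => t _; apply: ln_fact_le.
rewrite sumrB -natr_sum mK in lem.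
have lnK := ln_fact_ge R K.
have E1 : \sum_t (m t).+1%:R / K%:R * ln ((m t).+1%:R / K%:R) =
    K%:R^-1 * (\sum_t (m t).+1%:R * ln (m t).+1%:R)
    - (1 + #|T|%:R / K%:R) * ln K%:R :> R.
  have -> : 1 + #|T|%:R / K%:R = \sum_t (m t).+1%:R / K%:R :> R.
    rewrite -mulr_suml -natr_sum; under eq_bigr do rewrite -addn1.
    by rewrite big_split /= mK sum1_card natrD mulrDl divff ?lt0r_neq0.
  rewrite mulr_suml mulr_sumr -sumrB; apply: eq_bigr => t _.
  by rewrite ln_div ?posrE ?ltr0n //; ring.
have E2 : \sum_t (m t)%:R / K%:R * ln (c t) = K%:R^-1 * (\sum_t (m t)%:R * ln (c t)) :> R.
  by rewrite mulr_sumr; apply: eq_bigr => t _; ring.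
rewrite E1 E2.
set S := \sum_t (m t)%:R * _; set Q := \sum_t (m t).+1%:R * _ in lem *.
set L := ln K%:R in lnK *.
have -> : K%:R * (- (#|T|%:R * (K%:R^-1 * L)) -
   (K%:R^-1 * Q - (1 + #|T|%:R / K%:R) * L) + K%:R^-1 * S) =
   K%:R * L - Q + S :> R by field; rewrite lt0r_neq0.
(* The linear terms of the two factorial bounds are both [K] and cancel. *)
lra.
Qed.

(** The vector [K * p] solves the system for [K * alpha] instead of [N]. The defect is [o(K)], so
    its linear correction is too; rounding then costs a bounded error. *)
Lemma feasible_counts_cvg (R : realType) (T V : finType) (a : T -> V -> nat)
    (p : T -> R) (alpha : V -> R) (K : nat -> nat) (N : nat -> V -> nat) :
  (forall t, 0 < p t) ->
  (forall v, \sum_t p t * (a t v)%:R = alpha v) ->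
  K @ \oo --> \oo ->
  (forall n, exists z : T -> nat, forall v, (\sum_t z t * a t v)%N = N n v) ->
  (forall v, (N n v)%:R / (K n)%:R @[n --> \oo] --> alpha v) ->
  exists m : nat -> T -> nat,
    (\forall n \near \oo, forall v, (\sum_t m n t * a t v)%N = N n v) /\
    (forall t, (m n t)%:R / (K n)%:R @[n --> \oo] --> p t).
Proof.
move=> p_gt0 p_alpha Koo N_int N_alpha.
have [B BE] := linear_section (fun t v => (a t v)%:R : R).
have [C CP] := integral_combination_near R a.
pose y n t := (K n)%:R * p t
  + \sum_v ((N n v)%:R - (K n)%:R * alpha v) * B v t.
have /choice[mi miP] (n : nat) : exists m : T -> int,
    (forall v, \sum_t m t * (a t v)%:Z = (N n v)%:Z) /\
    (forall t, `|(m t)%:~R - y n t| <= C).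
  have [z zN] := N_int n.
  have [|m [mN my]] := CP (y n) (fun t => (z t)%:Z).
    move=> v; under eq_bigr do rewrite mulrDl.
    (* The defect lies in the image, as that of [z - K * p], so [B] inverts it and [y n] solves the
       system for [N] exactly. *)
    rewrite big_split /= (BE (fun t => (z t)%:R - (K n)%:R * p t)); last first.
      move=> j; rewrite -zN natr_sum -p_alpha mulr_sumr -sumrB.
      by apply: eq_bigr => t _; rewrite natrM; ring.
    under eq_bigr do rewrite -mulrA.
    rewrite -mulr_sumr p_alpha addrC subrK -zN natr_sum.
    by apply: eq_bigr => t _; rewrite natrM.
  exists m; split=> // v; rewrite mN -zN -[RHS]natz natr_sum.
  by apply: eq_bigr => t _; rewrite natrM !natz.
have Kinv := @cvg_natr_inv R K Koo; have /cvgnyPgt/(_ 0%N) K_pos := Koo.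
have mi_cvg t : (mi n t)%:~R / (K n)%:R @[n --> \oo] --> p t.
  pose S n := p t + \sum_v ((N n v)%:R / (K n)%:R - alpha v) * B v t.
  have S_cvg : S n @[n --> \oo] --> p t.
    have -> : p t = p t + \sum_v (alpha v - alpha v) * B v t.
      by rewrite big1 ?addr0 // => v _; rewrite subrr mul0r.
    apply: cvgD; first exact: cvg_cst.
    apply: (cvg_sum (f := fun v n => ((N n v)%:R / (K n)%:R - alpha v) * B v t)).
    move=> v; apply: cvgMr_tmp; apply: cvgB; first exact: N_alpha.
    exact: cvg_cst.
  have C_cvg : C * (K n)%:R^-1 @[n --> \oo] --> (0 : R).
    by rewrite -[X in _ --> X](mulr0 C); apply: cvgMl_tmp.
  apply: (@squeeze_cvgr _ _ _ _ (fun n => S n - C * (K n)%:R^-1)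
                                (fun n => S n + C * (K n)%:R^-1)).
  - near=> n.
    have K_gt0 : (0 < K n)%N by near: n.
    have k_gt0 : 0 < (K n)%:R :> R by rewrite ltr0n.
    have -> : S n = y n t / (K n)%:R.
      rewrite /S /y mulrDl mulr_suml mulrAC divff ?lt0r_neq0 // mul1r.
      congr (_ + _); apply: eq_bigr => v _.
      by field; rewrite lt0r_neq0.
    rewrite -mulrBl -mulrDl !ler_pM2r ?invr_gt0 //.
    by rewrite -ler_distl (miP n).2.
  - by rewrite -[X in _ --> X]subr0; apply: cvgB.
  - by rewrite -[X in _ --> X]addr0; apply: cvgD.
(* Strict positivity of [p] makes the integral solution nonnegative for large [n]; from then on the
   absolute values taken below change nothing. *)
have mi_gt0 : \forall n \near \oo, forall t, 0 <= mi n t.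
  apply: filter_forall => t; near=> n.
  have K_gt0 : (0 < K n)%N by near: n.
  have : 0 < (mi n t)%:~R / (K n)%:R :> R by near: n; apply: cvgr_gt (p_gt0 t).
  by rewrite pmulr_lgt0 ?invr_gt0 ?ltr0n // ltr0z => /ltW.
exists (fun n t => `|mi n t|%N); split=> [|t].
  near=> n => v; have m_ge0 : forall t, 0 <= mi n t by near: n.
  apply/eqP; rewrite -eqz_nat -(miP n).1 -[X in X == _]natz natr_sum.
  by apply/eqP/eq_bigr => t _; rewrite natrM !natz gez0_abs.
apply: (@squeeze_cvgr _ _ _ _ (fun n => (mi n t)%:~R / (K n)%:R)
                              (fun n => (mi n t)%:~R / (K n)%:R)) => //.
near=> n; have m_ge0 : forall t, 0 <= mi n t by near: n.
by rewrite natr_absz ger0_norm ?lexx.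
Unshelve. all: by end_near. Qed.

Lemma cvg_ln_mul (R : realType) (r : nat -> R) (p : R) : 0 < p ->
  r n @[n --> \oo] --> p -> r n * ln (r n) @[n --> \oo] --> p * ln p.
Proof.
move=> p_gt0 rp; apply: cvgM => //.
by apply: continuous_cvg => //; exact: continuous_ln.
Qed.

(** A squeeze: [U] evaluates the power at [x], [L] comes from the one type [m], and the choice of
    [p] makes their limits agree. *)
Lemma power_coef_cvg (R : realType) (T V : finType) (a : T -> V -> nat)
    (c : T -> R) (delta : nat) (x alpha : V -> R)
    (K : nat -> nat) (N : nat -> V -> nat) :
  (0 < delta)%N -> (forall t, \sum_v a t v = delta)%N ->
  (forall t, 0 < c t) -> (forall v, 0 < x v) ->
  let P := \sum_t c t * \prod_v x v ^+ a t v in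
  0 < P ->
  (forall v, \sum_t (c t * \prod_u x u ^+ a t u / P) * (a t v)%:R = alpha v) ->
  K @ \oo --> \oo ->
  (forall n, \sum_v N n v = K n * delta)%N ->
  (forall n, exists z : T -> nat, forall v, (\sum_t z t * a t v)%N = N n v) ->
  (forall v, (N n v)%:R / (K n)%:R @[n --> \oo] --> alpha v) ->
  (K n)%:R^-1 * ln (power_coef a c (K n) (N n)) @[n --> \oo] -->
    ln P - \sum_v alpha v * ln (x v).
Proof.
move=> delta_gt0 a_delta c_gt0 x_gt0 P P_gt0 p_alpha Koo NK N_int N_alpha.
have Kinv := @cvg_natr_inv R K Koo; have /cvgnyPgt/(_ 0%N) K_pos := Koo.
have xa_gt0 t : 0 < \prod_u x u ^+ a t u.
  by apply: prodr_gt0 => u _; rewrite exprn_gt0.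
pose p t := c t * \prod_u x u ^+ a t u / P.
have p_gt0 t : 0 < p t by rewrite divr_gt0 ?mulr_gt0.
have [m [mN m_cvg]] := feasible_counts_cvg p_gt0 p_alpha Koo N_int N_alpha.
(* All tiles have size [delta], so a solution for [N] automatically uses [K] tiles. *)
have mK : \forall n \near \oo, (\sum_t m n t = K n)%N.
  near=> n; have mNn : forall v, (\sum_t m n t * a t v)%N = N n v by near: n.
  apply/eqP; rewrite -(eqn_pmul2r delta_gt0) -NK; apply/eqP.
  rewrite big_distrl /= -(eq_bigr _ (fun v _ => mNn v)) exchange_big /=.
  by apply: eq_bigr => t _; rewrite -big_distrr /= a_delta.
pose L n : R := - (#|T|%:R * ((K n)%:R^-1 * ln (K n)%:R))
  - \sum_t ((m n t).+1%:R / (K n)%:R) * ln ((m n t).+1%:R / (K n)%:R)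
  + \sum_t ((m n t)%:R / (K n)%:R) * ln (c t).
pose U n : R := ln P - \sum_v (N n v)%:R / (K n)%:R * ln (x v).
apply: (@squeeze_cvgr _ _ _ _ L U).
- near=> n.
  have K_gt0 : (0 < K n)%N by near: n.
  have k_gt0 : 0 < (K n)%:R :> R by rewrite ltr0n.
  have mNn : forall v, (\sum_t m n t * a t v)%N = N n v by near: n.
  have mKn : (\sum_t m n t)%N = K n by near: n.
  have coef_ge := power_coef_ge c_gt0 mKn mNn.
  have low_gt0 : 0 < (K n)`!%:R / (\prod_t (m n t)`!)%:R * \prod_t c t ^+ m n t :> R.
    rewrite mulr_gt0 ?divr_gt0 ?ltr0n ?fact_gt0 //.
      by rewrite prodn_gt0 // => t; rewrite fact_gt0.
    by apply: prodr_gt0 => t _; rewrite exprn_gt0.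
  (* Comparing logarithms requires a positive coefficient, and the lower bound provides this. *)
  have coef_gt0 := lt_le_trans low_gt0 coef_ge.
  apply/andP; split.
    apply: le_trans (ln_multinomial_ge K_gt0 mKn c_gt0) _.
    by rewrite ler_pM2l ?invr_gt0 // ler_ln ?posrE.
  rewrite ler_pdivrMl // /U.
  have xN_gt0 : 0 < \prod_v x v ^+ N n v.
    by apply: prodr_gt0 => v _; rewrite exprn_gt0.
  have := power_coef_le a c_gt0 (K n) (N n) x_gt0.
  rewrite -ler_ln ?posrE ?mulr_gt0 ?exprn_gt0 // lnM ?posrE // lnXn // -/P.
  rewrite ln_prod => [|v]; last by rewrite exprn_gt0.
  rewrite mulrBr -lerBrDr mulr_natl mulr_sumr => /le_trans; apply.
  rewrite lerD2l lerN2 ler_sum // => v _.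
  by rewrite lnXn // mulrA mulrCA divff ?lt0r_neq0 // mulr1 mulr_natl.
- have r_cvg t : (m n t).+1%:R / (K n)%:R @[n --> \oo] --> p t.
    rewrite -[p t]addr0 (_ : (fun n => _) =
        fun n => (m n t)%:R / (K n)%:R + (K n)%:R^-1); first exact: cvgD.
    by apply/funext => n; rewrite -addn1 natrD mulrDl mul1r.
  (* Since [ln (p t / c t) = sum_v a t v * ln (x v) - ln P], averaging against [p], of total mass 1
     and mean [alpha], gives the limit of [U]. *)
  have -> : ln P - \sum_v alpha v * ln (x v) =
      - (#|T|%:R * 0) - \sum_t p t * ln (p t) + \sum_t p t * ln (c t).
    rewrite mulr0 oppr0 add0r [RHS]addrC -sumrB.
    have -> : ln P = \sum_t p t * ln P.
      by rewrite -mulr_suml /p -mulr_suml divff ?mul1r // lt0r_neq0.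
    have -> : \sum_v alpha v * ln (x v) =
        \sum_t p t * \sum_v (a t v)%:R * ln (x v).
      under eq_bigr do rewrite -p_alpha mulr_suml.
      rewrite exchange_big /=; apply: eq_bigr => t _; rewrite mulr_sumr.
      by apply: eq_bigr => v _; rewrite mulrA.
    rewrite -sumrB; apply: eq_bigr => t _; rewrite -!mulrBr; congr (_ * _).
    rewrite /p ln_div ?posrE ?mulr_gt0 // lnM ?posrE // ln_prod => [|v]; last first.
      by rewrite exprn_gt0.
    under [X in _ = _ - (_ + X - _)]eq_bigr do rewrite lnXn // -mulr_natl.
    by ring.
  apply: cvgD.
    apply: cvgB; first by apply: cvgN; apply: cvgMl_tmp; exact: cvg_ln_natr_div.
    apply: (cvg_sum (f := fun t n =>
      (m n t).+1%:R / (K n)%:R * ln ((m n t).+1%:R / (K n)%:R))) => t.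
    exact: cvg_ln_mul.
  apply: (cvg_sum (f := fun t n => (m n t)%:R / (K n)%:R * ln (c t))) => t.
  exact: cvgMr_tmp.
- apply: cvgB; first exact: cvg_cst.
  apply: (cvg_sum (f := fun v n => (N n v)%:R / (K n)%:R * ln (x v))) => v.
  exact: cvgMr_tmp.
Unshelve. all: by end_near. Qed.

(** * Criticality equations and conclusion *)

(** The Euler operator multiplies each monomial by its exponent in [x v]. This turns the criticality
    equations into the statement that [p] has mean [alpha]. *)
Lemma partial_tiling_poly (R : realType) (G : sgraph) (T : {fset tile G})
    (w : T -> R) (x : G -> R) (v : G) :
  x v * partial (tiling_poly w) v x =
  \sum_(t : T) w t / (\prod_u (val t u)`!%:R) * (\prod_u x u ^+ val t u)
    * (val t v)%:R.
Proof.
pose C (t : T) : R := w t / (\prod_u (val t u)`!%:R) * \prod_(u | u != v) x u ^+ val t u.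
have polyE : (fun s : R => tiling_poly w (fun u => if u == v then s else x u)) =
    \sum_(t : T) (C t \*: (id ^+ val t v)).
  apply/funext => s; rewrite fct_sumE; apply: eq_bigr => t _.
  rewrite /C prodf_div (bigD1 v) //= eqxx.
  rewrite (eq_bigr (fun u => x u ^+ val t u)) => [|u /negPf -> //].
  rewrite !fctE /= -[RHS]/(_ * _) -!mulrA; congr (_ * _).
  by rewrite [RHS]mulrC -mulrA mulrCA.
have derF : is_derive (x v) 1 (\sum_(t : T) (C t \*: (id ^+ val t v)) : R -> R)
    (\sum_(t : T) C t * ((val t v)%:R * x v ^+ (val t v).-1)).
  elim/big_ind2: _ => [||t _]; first exact: is_derive_cst.
    by move=> *; exact: is_deriveD.
  by apply: is_derive_eq; rewrite -[LHS]/(_ * (_ * _)) mulr1.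
rewrite /partial polyE derive1E derive_val mulr_sumr; apply: eq_bigr => t _.
(* At [k = 0] the truncated exponent is harmless because the factor [k] vanishes. *)
have natX (y : R) k : y * (k%:R * y ^+ k.-1) = y ^+ k * k%:R.
  by case: k => [|k]; rewrite ?mul0r ?mulr0 // exprS mulrCA mulrC.
rewrite mulrCA natX mulrA; congr (_ * _).
by rewrite /C -[LHS]mulrA; congr (_ * _); rewrite [RHS](bigD1 v) //= mulrC.
Qed.

Theorem mainTheorem3 (R : realType) (G : sgraph) (T : {fset tile G})
    (delta : nat) (delta_gt0 : (0 < delta)%N)
    (sizeT : forall t : T, tile_size (val t) = delta)
    (w : T -> R) (w_gt0 : forall t : T, 0 < w t)
    (alpha : G -> R)
    (alpha_feasible : feasible_real T alpha)
    (alpha_gt0 : forall v : G, 0 < alpha v)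
    (alpha_sum : \sum_(v : G) alpha v = delta%:R)
    (N : nat -> G -> nat)
    (N_feasible : forall n : nat,
       feasible_int T (fun v : G => (N n v)%:R : R))
    (N_infty : forall v : G, (fun n : nat => N n v) @ \oo --> \oo)
    (N_alpha : forall v : G,
       (fun n : nat => (N n v)%:R / (num_tiles delta (N n))%:R : R) @ \oo
         --> alpha v)
    (x : G -> R) (x_gt0 : forall v : G, 0 < x v)
    (x_crit : forall v : G,
       x v * partial (tiling_poly w) v x / tiling_poly w x = alpha v) :
  (fun n : nat =>
     (num_tiles delta (N n))%:R^-1 *
     ln ((num_tiles delta (N n))`!%:R / (\prod_(v : G) (N n v)`!)%:R *
         partition_function w (N n))) @ \oo
    --> ln (tiling_poly w x) - \sum_(v : G) alpha v * ln (x v).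
Proof.
(* Without vertices [alpha_sum] would force [delta = 0]; without tiles feasibility would force
   [alpha = 0]. *)
have [v0 _|G0] := pickP (@predT G); last first.
  move: alpha_sum; rewrite big_pred0 // => /esym/eqP.
  by rewrite pnatr_eq0 eqn0Ngt delta_gt0.
have [t0 _|T0] := pickP (@predT T); last first.
  have [c _ /(congr1 (fun f => f v0))] := alpha_feasible.
  rewrite /tile_map big_pred0 // => a0.
  by have := alpha_gt0 v0; rewrite -a0 ltxx.
have N_int n : exists z : T -> nat, forall v, (\sum_t z t * val t v)%N = N n v.
  have [c c_nat cN] := N_feasible n.
  exists (fun t => Num.truncn (c t)) => v; apply/eqP; rewrite -(eqr_nat R).
  rewrite -[X in _ == X](congr1 (fun f => f v) cN) natr_sum; apply/eqP/eq_bigr => t _.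
  by rewrite natrM truncnK.
pose K n := num_tiles delta (N n).
(* The division in [num_tiles] is exact: each tile contributes [delta] to the total. *)
have NK n : (\sum_v N n v = K n * delta)%N.
  rewrite /K /num_tiles divnK //; have [z zN] := N_int n.
  under eq_bigr do rewrite -zN.
  rewrite exchange_big /= dvdn_sum // => t _.
  by rewrite -big_distrr /= [X in (_ * X)%N]sizeT dvdn_mull.
have Koo : K @ \oo --> \oo.
  apply/cvgnyPge => A; have /cvgnyPge/(_ (A * delta)%N) := N_infty v0.
  apply: filterS => n AN; rewrite -(leq_pmul2r delta_gt0) -NK.
  apply: leq_trans AN _.
  by rewrite (bigD1 v0) //= leq_addr.
(* Absorbing the factorials into the weights turns the tiling polynomial into a plain sum of
   monomials. *)
pose c (t : T) := w t / \prod_u (val t u)`!%:R.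
have c_gt0 t : 0 < c t.
  by rewrite divr_gt0 // prodr_gt0 // => u _; rewrite ltr0n fact_gt0.
have PE : tiling_poly w x = \sum_t c t * \prod_u x u ^+ val t u.
  by apply: eq_bigr => t _; rewrite prodf_div mulrA mulrAC.
have xt_gt0 (t : T) : 0 < c t * \prod_u x u ^+ val t u.
  by rewrite mulr_gt0 // prodr_gt0 // => u _; rewrite exprn_gt0.
have P_gt0 : 0 < tiling_poly w x.
  rewrite PE (bigD1 t0) //= ltr_wpDr // sumr_ge0 // => t _; exact: ltW.
have crit v : \sum_t (c t * \prod_u x u ^+ val t u / tiling_poly w x)
    * (val t v)%:R = alpha v.
  rewrite -x_crit partial_tiling_poly mulr_suml.
  by apply: eq_bigr => t _; rewrite mulrAC.
rewrite PE in P_gt0 crit *.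
have := power_coef_cvg delta_gt0 sizeT c_gt0 x_gt0 P_gt0 crit Koo NK N_int N_alpha.
under eq_fun => n.
  rewrite (_ : power_coef _ _ _ _ = (K n)`!%:R / (\prod_v (N n v)`!)%:R
    * partition_function w (N n)); first over.
  by rewrite (partition_functionE delta_gt0 sizeT w (NK n)).
by [].
Qed.
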